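(* For every $n\geq 3$ the inclusion $\mathcal{T}_{n,\mathrm{FD}}\subset\mathcal{T}_{n,\mathrm{PD}}$ is strict: there exist partially decoupleable trilinear tensors in $\mathcal{T}_n$ that are not fully decoupleable.
   Context: $\mathcal{T}_n$ is the set of real $n\times n\times n$ tensors $\Gamma=(\Gamma^i_{jk})$ that are trilinear (completely symmetric), i.e. $\Gamma^i_{jk}=\Gamma^i_{kj}=\Gamma^j_{ik}$ for all $i,j,k$. The orthogonal group $O(n)$ acts on $\mathcal{T}_n$ by $$(\sigma\circ\Gamma)^i_{jk}=\sum_{i',j',k'}\sigma_{ii'}\sigma_{jj'}\sigma_{kk'}\Gamma^{i'}_{j'k'} .$$ $\mathcal{T}_{n,\mathrm{FD}}$ (fully decoupleable tensors) is the set of $\Gamma\in\mathcal{T}_n$ for which there is $\sigma\in O(n)$ such that for every $i\in\{1,\dots,n\}$, $(\sigma\circ\Gamma)^i_{jk}=0$ for all $(j,k)\neq(i,i)$. $\mathcal{T}_{n,\mathrm{PD}}$ (partially decoupleable tensors) is the set of $\Gamma\in\mathcal{T}_n$ for which there are $\sigma\in O(n)$ and some $i\in\{1,\dots,n\}$ such that $(\sigma\circ\Gamma)^i_{jk}=0$ for all $(j,k)\ne(i,i)$. *)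

(* Defs.v *)
From HB Require Import structures.
From mathcomp Require Import all_boot all_order all_algebra.
From mathcomp Require Import classical_sets reals.
Set Implicit Arguments.
Unset Strict Implicit.
Unset Printing Implicit Defensive.
Import Order.TTheory GRing.Theory Num.Theory.
Local Open Scope classical_set_scope.
Local Open Scope ring_scope.

(* [G i j k] stands for $\Gamma^i_{jk}$: the upper index comes first. *)
Definition tensor3 (R : realType) (n : nat) : Type :=
  'I_n -> 'I_n -> 'I_n -> R.

Definition trilinear_tensors (R : realType) (n : nat) : set (tensor3 R n) :=
  [set G | forall i j k, G i j k = G i k j /\ G i k j = G j i k].

Definition orthogonal_group (R : realType) (n : nat) : set 'M[R]_n :=
  [set s | s *m s^T = 1%:M].

Definition tensor_act (R : realType) (n : nat) (s : 'M[R]_n)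
    (G : tensor3 R n) : tensor3 R n :=
  fun i j k => \sum_(i' < n) \sum_(j' < n) \sum_(k' < n)
    s i i' * s j j' * s k k' * G i' j' k'.

Definition decoupled_at (R : realType) (n : nat) (G : tensor3 R n)
    (i : 'I_n) : Prop :=
  forall j k : 'I_n, (j, k) <> (i, i) -> G i j k = 0.

Definition fully_decoupleable (R : realType) (n : nat) : set (tensor3 R n) :=
  [set G | trilinear_tensors G /\
    exists2 s : 'M[R]_n, orthogonal_group s &
      forall i : 'I_n, decoupled_at (tensor_act s G) i].

Definition partially_decoupleable (R : realType) (n : nat) :
    set (tensor3 R n) :=
  [set G | trilinear_tensors G /\
    exists2 s : 'M[R]_n, orthogonal_group s &
      exists i : 'I_n, decoupled_at (tensor_act s G) i].

(* Main.v *)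
Require Import Defs.
From HB Require Import structures.
From mathcomp Require Import all_boot all_order all_algebra.
From mathcomp Require Import classical_sets reals.
From mathcomp Require Import ring.
Local Open Scope classical_set_scope.

(** A fully decoupleable tensor has the form
    [G i j k = \sum_a d a * s a i * s a j * s a k] with [s] orthogonal, so its
    contraction with itself, [\sum_l G i j l * G l k m], equals
    [\sum_a d a ^+ 2 * s a i * s a j * s a k * s a m] and is symmetric in all
    four indices.  The tensor of the cubic form [x_0 x_1^2] (up to a factor 3)
    does not involve the third coordinate, hence is partially decoupleable,
    but its self-contraction is not symmetric. *)

Import GRing.Theory.
Local Open Scope ring_scope.

Section SelfContraction.
Variables (R : realType) (n : nat).
Implicit Types (s : 'M[R]_n) (G : tensor3 R n).

(** The nested form lets each index slot be treated on its own by a one-index identity. *)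
Lemma tensor_act_nested s G i j k :
  tensor_act s G i j k =
  \sum_(i' < n) s i i' * \sum_(j' < n) s j j' * \sum_(k' < n) s k k' * G i' j' k'.
Proof.
apply: eq_bigr => i' _; rewrite mulr_sumr; apply: eq_bigr => j' _.
by rewrite !mulr_sumr; apply: eq_bigr => k' _; rewrite !mulrA.
Qed.

Lemma tensor_act1 G i j k : tensor_act 1%:M G i j k = G i j k.
Proof.
have sum1 (f : 'I_n -> R) b : \sum_(a < n) (1%:M : 'M[R]_n) b a * f a = f b.
  rewrite (bigD1 b) //= mxE eqxx mul1r big1 ?addr0 // => a /negbTE nab.
  by rewrite mxE eq_sym nab mul0r.
by rewrite tensor_act_nested !sum1.
Qed.

Lemma orthogonal_row_dot s a c :
  orthogonal_group s -> \sum_(l < n) s a l * s c l = (a == c)%:R.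
Proof.
move=> /(congr1 (fun M : 'M[R]_n => M a c)); rewrite !mxE => <-.
by apply: eq_bigr => l _; rewrite mxE.
Qed.

(** A right inverse of a square matrix is also a left inverse, so [s^T *m s] is the identity; it can
    thus be inserted in any index slot. *)
Lemma orthogonal_sumK s (f : 'I_n -> R) i : orthogonal_group s ->
  \sum_(a < n) s a i * \sum_(j < n) s a j * f j = f i.
Proof.
move=> /mulmx1C sTs.
transitivity ((s^T *m (s *m (\col_j f j))) i 0).
  rewrite mxE; apply: eq_bigr => a _; rewrite !mxE; congr (_ * _).
  by apply: eq_bigr => j _; rewrite !mxE.
by rewrite mulmxA sTs mul1mx mxE.
Qed.

(** Inserting [s^T *m s] in all three slots writes [G] as [s^T] acting on the decoupled tensor,
    whose only possibly nonzero entries are diagonal. *)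
Lemma fully_decoupled_expand s G : orthogonal_group s ->
  (forall i, decoupled_at (tensor_act s G) i) ->
  forall i j k, G i j k =
    \sum_(a < n) tensor_act s G a a a * s a i * s a j * s a k.
Proof.
move=> os dec i j k.
rewrite -[LHS](orthogonal_sumK _ (fun k => G i j k) _ os); apply: eq_bigr => c _.
rewrite -[X in _ * X](orthogonal_sumK _
  (fun j => \sum_(k < n) s c k * G i j k) _ os).
under eq_bigr => b _ do rewrite -[X in _ * X](orthogonal_sumK _
  (fun i => \sum_(j < n) s b j * \sum_(k < n) s c k * G i j k) _ os).
under eq_bigr => b _ do under eq_bigr => a _ do rewrite -tensor_act_nested.
(* With [c] fixed, decoupling kills the terms with [b != c], then those with [a != c]. *)
rewrite (bigD1 c) //= [X in _ * (_ + X) = _]big1 => [|b nbc]; last first.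
  rewrite big1 ?mulr0 // => a _; rewrite dec ?mulr0 // => -[ba ca].
  by rewrite ba ca eqxx in nbc.
rewrite (bigD1 c) //= [\sum_(a < n | a != c) _]big1 => [|a nac]; first by ring.
by rewrite dec ?mulr0 // => -[ca]; rewrite ca eqxx in nac.
Qed.

Lemma self_contraction_expand s G (d : 'I_n -> R) : orthogonal_group s ->
  (forall i j k, G i j k = \sum_(a < n) d a * s a i * s a j * s a k) ->
  forall i j k m, \sum_(l < n) G i j l * G l k m =
    \sum_(a < n) d a ^+ 2 * s a i * s a j * s a k * s a m.
Proof.
move=> os GE i j k m.
(* The rows of [s] are orthonormal, so pairing with row [a] extracts the [a]-th summand of
   [G i j]. *)
have rowG a : \sum_(l < n) s a l * G i j l = d a * s a i * s a j.
  transitivity (\sum_(c < n) d c * s c i * s c j * \sum_(l < n) s a l * s c l).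
    under eq_bigr => l _ do rewrite GE mulr_sumr.
    rewrite exchange_big; apply: eq_bigr => c _; rewrite mulr_sumr.
    by apply: eq_bigr => l _; ring.
  under eq_bigr => c _ do rewrite (orthogonal_row_dot _ _ _ os).
  rewrite (bigD1 a) //= eqxx mulr1 big1 ?addr0 // => c.
  by rewrite eq_sym => /negbTE ->; rewrite mulr0.
under eq_bigr => l _ do rewrite (GE l) mulr_sumr.
rewrite exchange_big; apply: eq_bigr => a _.
transitivity (d a * s a k * s a m * \sum_(l < n) s a l * G i j l).
  by rewrite mulr_sumr; apply: eq_bigr => l _; ring.
by rewrite rowG; ring.
Qed.

Lemma fully_decoupleable_contraction_sym G : fully_decoupleable G ->
  forall i j k m,
    \sum_(l < n) G i j l * G l k m = \sum_(l < n) G i k l * G l j m.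
Proof.
move=> [_ [s os dec]] i j k m.
have expand := self_contraction_expand _ _ _ os (fully_decoupled_expand _ _ os dec).
by rewrite !expand; apply: eq_bigr => a _; ring.
Qed.

(** The bounds exclude 2, 0, 0, leaving only the arrangements of 0, 1, 1. *)
Definition x0x1x1_tensor : tensor3 R n :=
  fun i j k => [&& (i <= 1)%N, (j <= 1)%N, (k <= 1)%N & (i + j + k == 2)%N]%:R.

Lemma x0x1x1_tensor_trilinear : trilinear_tensors x0x1x1_tensor.
Proof.
move=> i j k; rewrite /x0x1x1_tensor addnAC; split; congr (nat_of_bool _)%:R.
  by rewrite [(j <= 1)%N && _]andbCA.
rewrite -addnA [(i + _)%N]addnC [(k + j)%N]addnC addnAC.
by case: (i <= 1)%N (j <= 1)%N (k <= 1)%N => [] [] [].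
Qed.

End SelfContraction.

Theorem proposition3p6 (R : realType) (n : nat) (hn : (3 <= n)%N) :
  @fully_decoupleable R n `<=` @partially_decoupleable R n /\
  exists G : tensor3 R n,
    partially_decoupleable G /\ ~ fully_decoupleable G.
Proof.
pose o0 : 'I_n := Ordinal (leq_trans (isT : (0 < 3)%N) hn).
pose o1 : 'I_n := Ordinal (leq_trans (isT : (1 < 3)%N) hn).
pose o2 : 'I_n := Ordinal hn.
split=> [G [triG [s os dec]]|].
  by split=> //; exists s => //; exists o2.
exists (@x0x1x1_tensor R n); split.
  split; first exact: x0x1x1_tensor_trilinear.
  exists 1%:M; first by rewrite /orthogonal_group /= trmx1 mulmx1.
  by exists o2 => j k _; rewrite tensor_act1.
(* On the left [G 0 0 l] is always zero; on the right [G 0 1 l * G l 0 1] is 1 at [l = 1] and zero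
   elsewhere. Symmetry would give 0 = 1. *)
move=> /fully_decoupleable_contraction_sym /(_ o0 o0 o1 o1) /eqP.
rewrite big1 => [|l _]; last first.
  rewrite /x0x1x1_tensor /= add0n.
  by case: (nat_of_ord l) => [|[|l']] /=; rewrite mul0r.
rewrite (bigD1 o1) //= big1 => [|l nl1].
  by rewrite /x0x1x1_tensor /= mulr1 addr0 eq_sym oner_eq0.
have : nat_of_ord l != 1%N by apply: contra nl1 => /eqP l1; apply/eqP/val_inj.
by rewrite /x0x1x1_tensor /=; case: (nat_of_ord l) => [|[|l']] //= _; rewrite mul0r.
Qed.
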